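(* For any $\mathcal U\in\beta\mathbb N$, the upward cone $\{\mathcal V\in\beta\mathbb N:\mathcal U\leq_{\mathrm{fe}}\mathcal V\}$ is a closed, two-sided ideal in $\beta\mathbb N$. It is the smallest closed right ideal containing $\mathcal U$, and therefore it is also the smallest closed two-sided ideal containing $\mathcal U$.
   Context: $\mathbb N$ contains $0$. For $A\subseteq\mathbb N$ and $k\in\mathbb N$: $A+k=\{a+k:a\in A\}$ and $A-k=\{x\in\mathbb N:x+k\in A\}$. For $A,B\subseteq\mathbb N$, $A\leq_{\mathrm{fe}}B$ means that for each finite $F\subseteq A$ there is $k\in\mathbb N$ with $F+k\subseteq B$. For ultrafilters $\mathcal U,\mathcal V$ on $\mathbb N$, $\mathcal U\leq_{\mathrm{fe}}\mathcal V$ means that for each $B\in\mathcal V$ there is some $A\in\mathcal U$ with $A\leq_{\mathrm{fe}}B$. $\beta\mathbb N$ is the space of all ultrafilters on $\mathbb N$ (principal ones included), with basic open sets $\overline A=\{\mathcal U\in\beta\mathbb N:A\in\mathcal U\}$ for $A\subseteq\mathbb N$; it is a semigroup under $\mathcal U+\mathcal V=\{X\subseteq\mathbb N:\{k\in\mathbb N:X-k\in\mathcal V\}\in\mathcal U\}$. Ideals are taken in the semigroup $(\beta\mathbb N,+)$: a nonempty $I\subseteq\beta\mathbb N$ is a right ideal if $\mathcal V+\mathcal W\in I$ for all $\mathcal V\in I$, $\mathcal W\in\beta\mathbb N$; a left ideal if $\mathcal W+\mathcal V\in I$ for all such $\mathcal V,\mathcal W$; and two-sided if it is both. (Thus $\{\mathcal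 U+\mathcal W:\mathcal W\in\beta\mathbb N\}$ is the right ideal generated by $\mathcal U$.) *)

(* Defs.v *)
From HB Require Import structures.
From mathcomp Require Import all_boot all_order all_algebra.
From mathcomp Require Import all_classical.
From mathcomp Require Import topology_structure.

Set Implicit Arguments.
Unset Strict Implicit.
Unset Printing Implicit Defensive.

Import GRing.Theory.
Local Open Scope classical_set_scope.
Local Open Scope ring_scope.

Definition shiftD (A : set nat) (k : nat) : set nat :=
  [set (a + k)%N | a in A].

Definition shiftB (A : set nat) (k : nat) : set nat :=
  [set x | A (x + k)%N].

Definition set_le_fe (A B : set nat) : Prop :=
  forall F : set nat, finite_set F -> F `<=` A ->
    exists k : nat, shiftD F k `<=` B.

Record betaN := BetaN {
  ultra_sets :> set nat -> Prop ;
  betaN_ultra : @UltraFilter nat ultra_sets }.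

#[global] Existing Instance betaN_ultra.

Lemma betaN_eq (U V : betaN) : ultra_sets U = ultra_sets V -> U = V.
Proof.
case: U V => [U hU] [V hV] /= eUV; rewrite eUV in hU *.
by rewrite (Prop_irrelevance hU hV).
Qed.

HB.instance Definition _ := gen_eqMixin betaN.
HB.instance Definition _ := gen_choiceMixin betaN.

Definition basic_open (A : set nat) : set betaN := [set U : betaN | U A].

Lemma basic_open_cover : \bigcup_(A in @setT (set nat)) basic_open A = setT.
Proof.
by apply/seteqP; split=> // U _; exists setT => //; exact: (@filterT _ U).
Qed.

Lemma basic_open_join (A B : set nat) (U : betaN) :
  [set: set nat] A -> [set: set nat] B -> basic_open A U -> basic_open B U ->
  exists C, [/\ [set: set nat] C, basic_open C U &
                basic_open C `<=` basic_open A `&` basic_open B].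
Proof.
move=> _ _ UA UB; exists (A `&` B); split => //; first exact: (@filterI _ U).
by move=> V VAB; split; apply: (@filterS _ V _ _ _ _ VAB) => x [].
Qed.

HB.instance Definition _ :=
  isBaseTopological.Build betaN basic_open_cover basic_open_join.

Definition le_fe (U V : betaN) : Prop :=
  forall B : set nat, V B -> exists2 A : set nat, U A & set_le_fe A B.

Definition fe_cone (U : betaN) : set betaN := [set V | le_fe U V].

Definition ultra_add (U V : set_system nat) : set_system nat :=
  [set X | U [set k | V (shiftB X k)]].

Lemma ultra_add_ultra (U V : betaN) : UltraFilter (ultra_add U V).
Proof.
have PF : ProperFilter (ultra_add U V).
  apply: Build_ProperFilter_ex.
    move=> X UVX; have [k Vk] := @filter_ex _ U _ _ UVX.
    by have [x Xx] := @filter_ex _ V _ _ Vk; exists (x + k)%N.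
  split.
  - apply: (@filterS _ U _ setT); last exact: filterT.
    by move=> k _; exact: (@filterT _ V).
  - move=> X Y UX UY.
    apply: (@filterS _ U _ _ _ _ (@filterI _ U _ _ _ UX UY)) => k [VX VY].
    exact: (@filterI _ V _ _ _ VX VY).
  - move=> X Y XY; apply: (@filterS _ U) => k.
    by apply: (@filterS _ V) => x; exact: XY.
split=> // G PG UVG; apply/seteqP; split => // X GX.
have [//|UnX] := in_ultra_setVsetC [set k | V (shiftB X k)] (betaN_ultra U).
suff /UVG GnX : ultra_add U V (~` X).
  by have [x []] := @filter_ex _ G _ _ (@filterI _ G _ _ _ GX GnX).
apply: (@filterS _ U _ _ _ _ UnX) => k nVX.
by have [|] := in_ultra_setVsetC (shiftB X k) (betaN_ultra V).
Qed.

(* The instance carries the addition only: the additive semigroups of the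
   library are commutative, which betaN is not. *)
HB.instance Definition _ :=
  Algebra.hasAdd.Build betaN (fun U V => BetaN (ultra_add_ultra U V)).

Lemma betaN_addE (U V : betaN) (X : set nat) :
  (U + V) X = U [set k | V (shiftB X k)].
Proof. by []. Qed.

Lemma betaN_addA (U V W : betaN) : U + (V + W) = U + V + W.
Proof.
apply/betaN_eq/funext => X; rewrite !betaN_addE; congr (ultra_sets U _).
apply/funext => k; rewrite /= /shiftB /=; congr (ultra_sets V _).
apply/funext => l /=; congr (ultra_sets W _).
by apply/funext => x /=; rewrite addnA.
Qed.

Definition right_ideal (I : set betaN) : Prop :=
  I !=set0 /\ forall V W : betaN, I V -> I (V + W).

Definition left_ideal (I : set betaN) : Prop :=
  I !=set0 /\ forall V W : betaN, I V -> I (W + V).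

Definition two_sided_ideal (I : set betaN) : Prop :=
  right_ideal I /\ left_ideal I.

Definition is_smallest (T : Type) (P : set (set T)) (A : set T) : Prop :=
  P A /\ forall B : set T, P B -> A `<=` B.

(* Main.v *)
(* For fixed B, A is finitely embeddable in B iff the sets B - k, k in A, have
   the finite intersection property, i.e. all belong to one ultrafilter W. Hence
   U <=fe V iff every B in V belongs to some U + W, which says that V is in the
   closure of U + betaN: the cone is the closure of the right ideal generated
   by U. *)
Require Import Defs.
From mathcomp Require Import all_boot all_order all_algebra.
From mathcomp Require Import finmap all_classical.
From mathcomp Require Import topology_structure.

Local Open Scope classical_set_scope.

Lemma open_basic_open (A : set nat) : open (basic_open A).
Proof.
by exists [set A]; rewrite ?bigcup_set1.
Qed.

(** The sets [basic_open B] form a base, so it suffices to test neighbourhoods of [V] of this form,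
    that is, with [B] in [V]. *)
Lemma closure_betaNE (I : set betaN) :
  closure I = [set V | forall B, V B -> exists2 W : betaN, I W & W B].
Proof.
apply/seteqP; split=> [V clV B VB|V clV X].
  have [|W [IW WB]] := clV (basic_open B); last by exists W.
  by apply: open_nbhs_nbhs; split=> //; exact: open_basic_open.
rewrite nbhsE => -[O [[D _ <-] [B DB VB]] sOX].
have [W IW WB] := clV _ VB.
by exists W; split=> //; apply: sOX; exists B.
Qed.

Lemma set_le_feP (A B : set nat) :
  set_le_fe A B <-> exists W : betaN, forall k, A k -> W (shiftB B k).
Proof.
split=> [AB|[W AW] F finF FA].
  have /finI_filter/ultraFilterLemma[G [UG sG]] : finI A (shiftB B).
    (* A shift [x] carrying [F] into [B] is itself a common point of the sets [B - k], [k] in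
       [F]. *)
    move=> F FA; have [||x xB] := AB [set` F]; first exact: finite_fset.
      by move=> k /FA; rewrite inE.
    by exists x => k Fk; rewrite /shiftB/= addnC; apply: xB; exists k.
  exists (BetaN UG) => k Ak; apply: sG.
  by exists (shiftB B k) => //; exact: finI_from1.
have /finite_fsetP[E FE] := finF.
have WE : W (\bigcap_(k in [set` E]) shiftB B k).
  by apply: filter_bigI => k Ek; apply/AW/FA; rewrite FE.
have [x xE] := @filter_ex _ W _ _ WE.
by exists x => _ [k + <-]; rewrite FE addnC => /xE.
Qed.

Lemma fe_cone_closureE (U : betaN) :
  fe_cone U = closure [set (U + W)%R | W in [set: betaN]].
Proof.
rewrite closure_betaNE; apply/seteqP; split=> V UV B /UV.
  move=> [A UA /set_le_feP[W AW]]; exists (U + W)%R; first by exists W.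
  by rewrite betaN_addE; exact: (@filterS _ U _ _ _ AW UA).
move=> [_ [W _ <-]]; rewrite betaN_addE => UWB.
(* The largest set that [W] embeds in [B]; it lies in [U] because [B] lies in [U + W]. *)
by exists [set k | W (shiftB B k)] => //; apply/set_le_feP; exists W.
Qed.

Lemma le_fe_refl (U : betaN) : le_fe U U.
Proof.
move=> B UB; exists B => // F _ FB.
by exists 0%N => _ [k Fk <-]; rewrite addn0; exact: FB.
Qed.

(** If [B] is in [W + V], some [B - k] is in [V]; a shift by [x] into [B - k] becomes a shift by
    [x + k] into [B]. *)
Lemma le_fe_addl (U V W : betaN) : le_fe U V -> le_fe U (W + V)%R.
Proof.
move=> UV B; rewrite betaN_addE => WVB.
have [k /UV[A UA AB]] := @filter_ex _ W _ _ WVB.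
exists A => // F finF FA; have [x xB] := AB F finF FA.
exists (x + k)%N => _ [a Fa <-]; rewrite addnA.
by apply: xB; exists a.
Qed.

(** If [W'] witnesses that [A] embeds in the set of [k] with [B - k] in [W], then [W' + W] witnesses
    that [A] embeds in [B]. *)
Lemma le_fe_addr (U V W : betaN) : le_fe U V -> le_fe U (V + W)%R.
Proof.
move=> UV B; rewrite betaN_addE => /UV[A UA /set_le_feP[W' AW']].
exists A => //; apply/set_le_feP; exists (W' + W)%R => k /AW' W'k.
rewrite betaN_addE; apply: (@filterS _ W' _ _ _ _ W'k) => x.
by apply: (@filterS _ W) => y; rewrite /shiftB/= addnA.
Qed.

Theorem corollary14 (U : betaN) :
  [/\ closed (fe_cone U) /\ two_sided_ideal (fe_cone U),
      is_smallest
        [set I : set betaN | [/\ closed I, right_ideal I & I U]]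
        (fe_cone U)
    & is_smallest
        [set I : set betaN | [/\ closed I, two_sided_ideal I & I U]]
        (fe_cone U)].
Proof.
have UU : fe_cone U U by exact: le_fe_refl.
have clU : closed (fe_cone U) by rewrite fe_cone_closureE; exact: closed_closure.
have rU : right_ideal (fe_cone U).
  by split=> [|V W]; [exists U | exact: le_fe_addr].
have lU : left_ideal (fe_cone U).
  by split=> [|V W]; [exists U | exact: le_fe_addl].
have minU (I : set betaN) : closed I -> right_ideal I -> I U -> fe_cone U `<=` I.
  (* The closure is the least closed superset, and a right ideal containing [U] contains every
     [U + W]. *)
  move=> clI [_ rI] IU; rewrite fe_cone_closureE closureE.
  by apply: smallest_sub => // _ [W _ <-]; exact: rI.
split=> //; split=> // I [clI]; first exact: minU.
by move=> [rI _]; exact: minU.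
Qed.
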